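(* Let $M$ be a smooth oriented surface in $E^3$ without umbilic points and without critical points of its mean curvature $H$, with notation as in the context, and let $(s,t)$ be local coordinates on $M$ in which $\xi_1=e(s)\,ds$, $\xi_2=e(s)\,dt$ with $e(s)>0$ and in which $A,H,J$ are functions of $s$ only. Put $Q(s)=H'(s)/J(s)=A(s)e(s)>0$. Then the equations $$d\alpha_1=0,\qquad d\alpha_2=\alpha_1\wedge\alpha_2$$ are equivalent to the system $$\sin(2\psi)(\log Q)_s+2\cos(2\psi)\,\psi_s-2\sin(2\psi)\,\psi_t=0,\qquad \cos(2\psi)(\log Q)_s-2\sin(2\psi)\,\psi_s-2\cos(2\psi)\,\psi_t=Q .$$ Moreover, this system is equivalent to the first-order system $$\psi_s=-\tfrac12 Q\sin(2\psi),\qquad \psi_t=\tfrac12(\log Q)_s-\tfrac12 Q\cos(2\psi).$$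
   Context: The surface $M$ carries an orthonormal frame $e_1,e_2,e_3$ with $e_3$ the unit normal and $e_1,e_2$ along principal directions; $\omega_1,\omega_2$ is the coframe dual to $e_1,e_2$, and $\omega_{12}=h\omega_1+k\omega_2$ is the connection form, i.e. $d\omega_1=\omega_{12}\wedge\omega_2$, $d\omega_2=\omega_1\wedge\omega_{12}$. The principal curvatures are $a>c$ (so $\omega_{13}=a\omega_1$, $\omega_{23}=c\omega_2$), $H=\frac12(a+c)$, $J=\frac12(a-c)>0$. By the Codazzi equations there are functions $u,v$ with $\frac{1}{a-c}da-h\omega_2=(u-k)\omega_1$ and $\frac1{a-c}dc-k\omega_1=(v-h)\omega_2$; in particular $dH=J(u\omega_1+v\omega_2)$. Set $A=\sqrt{u^2+v^2}>0$ (positive since $dH\neq0$), and let $\psi$ be a local smooth function with $u=A\cos\psi$, $v=A\sin\psi$. Define $\alpha_1=u\omega_1-v\omega_2$, $\alpha_2=v\omega_1+u\omega_2$, and $\xi_1=\cos\psi\,\omega_1+\sin\psi\,\omega_2$, $\xi_2=-\sin\psi\,\omega_1+\cos\psi\,\omega_2$. Thus $dH=AJ\xi_1$. Primes denote $d/ds$ and subscripts $s,t$ denote partial derivatives. *)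

(* Defs.v *)
From Stdlib Require Export Reals.
From Coquelicot Require Export Coquelicot.
Open Scope R_scope.

(* A surface with local coordinates (s,t) is an immersed patch X : U -> E^3 over an
   open U in the (s,t)-plane; all data are total functions of (s,t), and only their
   values on U matter. *)

Definition Ds (f : R -> R -> R) : R -> R -> R := fun s t => Derive (fun x => f x t) s.
Definition Dt (f : R -> R -> R) : R -> R -> R := fun s t => Derive (fun y => f s y) t.

Definition smooth_on (U : R * R -> Prop) (f : R -> R -> R) : Prop :=
  forall n s t, U (s, t) -> ex_diff_n f n s t.

Definition eq_on {T : Type} (U : R * R -> Prop) (f g : R -> R -> T) : Prop :=
  forall s t, U (s, t) -> f s t = g s t.

Definition E3 : Type := (R * R * R)%type.

Definition dot (x y : E3) : R :=
  fst (fst x) * fst (fst y) + snd (fst x) * snd (fst y) + snd x * snd y.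

Definition comp1 (W : R -> R -> E3) : R -> R -> R := fun s t => fst (fst (W s t)).
Definition comp2 (W : R -> R -> E3) : R -> R -> R := fun s t => snd (fst (W s t)).
Definition comp3 (W : R -> R -> E3) : R -> R -> R := fun s t => snd (W s t).

Definition Ds_vec (W : R -> R -> E3) : R -> R -> E3 := fun s t =>
  (Ds (comp1 W) s t, Ds (comp2 W) s t, Ds (comp3 W) s t).
Definition Dt_vec (W : R -> R -> E3) : R -> R -> E3 := fun s t =>
  (Dt (comp1 W) s t, Dt (comp2 W) s t, Dt (comp3 W) s t).

Definition smooth_vec_on (U : R * R -> Prop) (W : R -> R -> E3) : Prop :=
  smooth_on U (comp1 W) /\ smooth_on U (comp2 W) /\ smooth_on U (comp3 W).

(* The 1-form p ds + q dt is the function (s,t) |-> (p(s,t), q(s,t)); a 2-form is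
   identified with its coefficient on ds /\ dt. *)
Definition form1 : Type := R -> R -> R * R.

Definition form_add (w z : form1) : form1 := fun s t =>
  (fst (w s t) + fst (z s t), snd (w s t) + snd (z s t)).
Definition form_sub (w z : form1) : form1 := fun s t =>
  (fst (w s t) - fst (z s t), snd (w s t) - snd (z s t)).
Definition form_mul (f : R -> R -> R) (w : form1) : form1 := fun s t =>
  (f s t * fst (w s t), f s t * snd (w s t)).
Definition wedge (w z : form1) : R -> R -> R := fun s t =>
  fst (w s t) * snd (z s t) - snd (w s t) * fst (z s t).
Definition d0 (f : R -> R -> R) : form1 := fun s t => (Ds f s t, Dt f s t).
Definition d1 (w : form1) : R -> R -> R := fun s t =>
  Ds (fun x y => snd (w x y)) s t - Dt (fun x y => fst (w x y)) s t.

Declare Scope form_scope.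
Delimit Scope form_scope with form.
Bind Scope form_scope with form1.
Notation "w [+] z" := (form_add w z) (at level 50, left associativity) : form_scope.
Notation "w [-] z" := (form_sub w z) (at level 50, left associativity) : form_scope.
Notation "f [*] w" := (form_mul f%R w) (at level 40, left associativity) : form_scope.
Notation "w [^] z" := (wedge w z) (at level 40, left associativity) : form_scope.
Open Scope form_scope.

(* The vector-valued 1-form dW paired with V: < dW, V >. *)
Definition dform (W V : R -> R -> E3) : form1 := fun s t =>
  (dot (Ds_vec W s t) (V s t), dot (Dt_vec W s t) (V s t)).

(* dX(Y) is the tangent vector with coordinates Y, so for orthonormal tangent e_1, e_2
   the dual coframe is omega_i = < dX, e_i >. *)
Definition coframe (X ei : R -> R -> E3) : form1 := dform X ei.

(* The unit normal field e3 fixes the orientation of the surface. *)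
Record framed_surface (U : R * R -> Prop) (X e1 e2 e3 : R -> R -> E3) : Prop := {
  fs_open : open U;
  fs_smooth : smooth_vec_on U X;
  fs_smooth1 : smooth_vec_on U e1;
  fs_smooth2 : smooth_vec_on U e2;
  fs_smooth3 : smooth_vec_on U e3;
  fs_immersion : forall s t, U (s, t) -> forall l m : R,
    plus (scal l (Ds_vec X s t)) (scal m (Dt_vec X s t)) = zero ->
    l = 0 /\ m = 0;
  fs_orthonormal : forall s t, U (s, t) ->
    (dot (e1 s t) (e1 s t) = 1 /\ dot (e2 s t) (e2 s t) = 1 /\
     dot (e3 s t) (e3 s t) = 1) /\
    (dot (e1 s t) (e2 s t) = 0 /\ dot (e1 s t) (e3 s t) = 0 /\
     dot (e2 s t) (e3 s t) = 0);
  fs_normal : forall s t, U (s, t) ->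
    dot (Ds_vec X s t) (e3 s t) = 0 /\ dot (Dt_vec X s t) (e3 s t) = 0
}.

(* omega_13 = < de_1, e_3 > = a omega_1 and omega_23 = < de_2, e_3 > = c omega_2: e_1, e_2
   are principal directions with curvatures a, c; a > c rules out umbilic points. *)
Record principal_frame (U : R * R -> Prop) (X e1 e2 e3 : R -> R -> E3)
    (a c : R -> R -> R) : Prop := {
  pf_smooth_a : smooth_on U a;
  pf_smooth_c : smooth_on U c;
  pf_omega13 : eq_on U (dform e1 e3) (a [*] coframe X e1);
  pf_omega23 : eq_on U (dform e2 e3) (c [*] coframe X e2);
  pf_no_umbilic : forall s t, U (s, t) -> a s t > c s t
}.

(* h w1 + k w2 is the connection form omega_12 of the coframe w1, w2. *)
Record connection (U : R * R -> Prop) (w1 w2 : form1) (h k : R -> R -> R) : Prop := {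
  cn_smooth_h : smooth_on U h;
  cn_smooth_k : smooth_on U k;
  cn_dw1 : eq_on U (d1 w1) ((h [*] w1 [+] k [*] w2) [^] w2);
  cn_dw2 : eq_on U (d1 w2) (w1 [^] (h [*] w1 [+] k [*] w2))
}.

Record codazzi_functions (U : R * R -> Prop) (w1 w2 : form1)
    (a c h k u v : R -> R -> R) : Prop := {
  cz_smooth_u : smooth_on U u;
  cz_smooth_v : smooth_on U v;
  cz_da : eq_on U
    ((fun s t => 1 / (a s t - c s t)) [*] d0 a [-] h [*] w2)
    ((fun s t => u s t - k s t) [*] w1);
  cz_dc : eq_on U
    ((fun s t => 1 / (a s t - c s t)) [*] d0 c [-] k [*] w1)
    ((fun s t => v s t - h s t) [*] w2)
}.

Definition Hfun (a c : R -> R -> R) : R -> R -> R := fun s t => / 2 * (a s t + c s t).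
Definition Jfun (a c : R -> R -> R) : R -> R -> R := fun s t => / 2 * (a s t - c s t).
Definition Afun (u v : R -> R -> R) : R -> R -> R := fun s t => sqrt (u s t ^ 2 + v s t ^ 2).

Definition alpha1 (w1 w2 : form1) (u v : R -> R -> R) : form1 := u [*] w1 [-] v [*] w2.
Definition alpha2 (w1 w2 : form1) (u v : R -> R -> R) : form1 := v [*] w1 [+] u [*] w2.

Definition xi1 (w1 w2 : form1) (psi : R -> R -> R) : form1 :=
  (fun s t => cos (psi s t)) [*] w1 [+] (fun s t => sin (psi s t)) [*] w2.
Definition xi2 (w1 w2 : form1) (psi : R -> R -> R) : form1 :=
  (fun s t => - sin (psi s t)) [*] w1 [+] (fun s t => cos (psi s t)) [*] w2.

Record polar_angle (U : R * R -> Prop) (u v psi : R -> R -> R) : Prop := {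
  pa_smooth : smooth_on U psi;
  pa_u : eq_on U u (fun s t => Afun u v s t * cos (psi s t));
  pa_v : eq_on U v (fun s t => Afun u v s t * sin (psi s t))
}.

(* Main.v *)
(* Since w1 = cos psi xi1 - sin psi xi2 and w2 = sin psi xi1 + cos psi xi2, the forms
   alpha_1, alpha_2 arise from A xi1 = Q ds and A xi2 = Q dt by a rotation through 2 psi:
   alpha_1 = Q (cos 2psi ds - sin 2psi dt), alpha_2 = Q (sin 2psi ds + cos 2psi dt).
   Differentiating these and dividing by Q gives the first system, which a rotation
   through 2 psi solves for psi_s and psi_t. *)
Require Import Defs.
From Stdlib Require Import Lra.

(** * Locality of partial derivatives on an open set of the plane *)

Lemma locally_slice_s (U : R * R -> Prop) (s t : R) :
  open U -> U (s, t) -> locally s (fun x => U (x, t)).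
Proof.
  intros oU Ust. destruct (oU _ Ust) as [eps Heps]. exists eps. intros x Hx.
  apply Heps. split; [exact Hx | apply ball_center].
Qed.

Lemma locally_slice_t (U : R * R -> Prop) (s t : R) :
  open U -> U (s, t) -> locally t (fun y => U (s, y)).
Proof.
  intros oU Ust. destruct (oU _ Ust) as [eps Heps]. exists eps. intros y Hy.
  apply Heps. split; [apply ball_center | exact Hy].
Qed.

Lemma Ds_eq_on (U : R * R -> Prop) (f g : R -> R -> R) (s t : R) :
  open U -> eq_on U f g -> U (s, t) -> Ds f s t = Ds g s t.
Proof.
  intros oU fg Ust. apply Derive_ext_loc.
  apply (filter_imp (fun x => U (x, t))); [intros x; apply fg |].
  now apply locally_slice_s.
Qed.

Lemma Dt_eq_on (U : R * R -> Prop) (f g : R -> R -> R) (s t : R) :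
  open U -> eq_on U f g -> U (s, t) -> Dt f s t = Dt g s t.
Proof.
  intros oU fg Ust. apply Derive_ext_loc.
  apply (filter_imp (fun y => U (s, y))); [intros y; apply fg |].
  now apply locally_slice_t.
Qed.

Lemma d1_eq_on (U : R * R -> Prop) (w z : form1) (s t : R) :
  open U -> eq_on U w z -> U (s, t) -> d1 w s t = d1 z s t.
Proof.
  intros oU wz Ust. unfold d1. apply (f_equal2 Rminus).
  - apply (Ds_eq_on U); [assumption | | assumption]. intros x y Uxy. now rewrite wz.
  - apply (Dt_eq_on U); [assumption | | assumption].
    intros x y Uxy. now rewrite wz.
Qed.

Lemma ex_derive_s (U : R * R -> Prop) (f : R -> R -> R) (s t : R) :
  smooth_on U f -> U (s, t) -> ex_derive (fun x => f x t) s.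
Proof. intros sf Ust. exact (proj1 (proj2 (sf 1%nat s t Ust))). Qed.

Lemma ex_derive_t (U : R * R -> Prop) (f : R -> R -> R) (s t : R) :
  smooth_on U f -> U (s, t) -> ex_derive (fun y => f s y) t.
Proof. intros sf Ust. exact (proj1 (proj2 (proj2 (sf 1%nat s t Ust)))). Qed.

Lemma smooth_on_Ds (U : R * R -> Prop) (f : R -> R -> R) :
  smooth_on U f -> smooth_on U (Ds f).
(* Order [S n] of [ex_diff_n] consists of continuity, the two partial derivatives, and order [n] for
   each of them. *)
Proof. intros sf n s t Ust. exact (proj1 (proj2 (proj2 (proj2 (sf (S n) s t Ust))))). Qed.

(** * The differential of the mean curvature *)

Lemma Ds_Hfun (U : R * R -> Prop) (a c : R -> R -> R) (s t : R) :
  smooth_on U a -> smooth_on U c -> U (s, t) ->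
  Ds (Hfun a c) s t = / 2 * (Ds a s t + Ds c s t).
Proof.
  intros sa sc Ust. unfold Ds, Hfun. rewrite Derive_scal, Derive_plus; [reflexivity | |];
    now apply (ex_derive_s U).
Qed.

Lemma Dt_Hfun (U : R * R -> Prop) (a c : R -> R -> R) (s t : R) :
  smooth_on U a -> smooth_on U c -> U (s, t) ->
  Dt (Hfun a c) s t = / 2 * (Dt a s t + Dt c s t).
Proof.
  intros sa sc Ust. unfold Dt, Hfun. rewrite Derive_scal, Derive_plus; [reflexivity | |];
    now apply (ex_derive_t U).
Qed.

(** Adding the two Codazzi relations cancels the connection terms in [h] and [k] and leaves
    [da + dc = (a - c)(u w1 + v w2)]; halving gives the claim. *)
Lemma d0_Hfun (U : R * R -> Prop) (w1 w2 : form1) (a c h k u v : R -> R -> R) :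
  smooth_on U a -> smooth_on U c -> (forall s t, U (s, t) -> a s t > c s t) ->
  codazzi_functions U w1 w2 a c h k u v ->
  eq_on U (d0 (Hfun a c)) (Jfun a c [*] (u [*] w1 [+] v [*] w2)).
Proof.
  intros sa sc ac [_ _ cda cdc] s t Ust.
  specialize (ac s t Ust). specialize (cda s t Ust). specialize (cdc s t Ust).
  unfold d0. rewrite (Ds_Hfun U), (Dt_Hfun U) by assumption.
  unfold form_add, form_sub, form_mul, d0, Jfun in *. simpl in *.
  injection cda as as_ at_. injection cdc as cs_ ct_.
  (* Solves one component of a Codazzi relation for the partial derivative [p], dividing by
     [a - c > 0]; the value of [x] is fixed by unification with [eq_refl]. *)
  assert (solve : forall p q r x : R,
            1 / (a s t - c s t) * p - q = r ->
            x = r + q -> p = (a s t - c s t) * x).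
  { intros p q r x Hp ->. rewrite <- Hp. field. lra. }
  rewrite (solve _ _ _ _ as_ eq_refl), (solve _ _ _ _ at_ eq_refl),
    (solve _ _ _ _ cs_ eq_refl), (solve _ _ _ _ ct_ eq_refl).
  f_equal; ring.
Qed.

(** * Recovering the coframe from the rotated forms *)

Lemma sin2_cos2_pow (x : R) : sin x ^ 2 + cos x ^ 2 = 1.
Proof. rewrite <- !Rsqr_pow2. apply sin2_cos2. Qed.

(** The inverse rotation gives [w1 = cos psi xi1 - sin psi xi2] and
    [w2 = sin psi xi1 + cos psi xi2]. *)
Lemma coframe_of_xi (w1 w2 : form1) (psi : R -> R -> R) (s t e : R) :
  xi1 w1 w2 psi s t = (e, 0) -> xi2 w1 w2 psi s t = (0, e) ->
  w1 s t = (e * cos (psi s t), - (e * sin (psi s t))) /\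
  w2 s t = (e * sin (psi s t), e * cos (psi s t)).
Proof.
  intros x1 x2. unfold xi1, xi2, form_add, form_mul in *. simpl in *.
  destruct (w1 s t) as [p1 q1], (w2 s t) as [p2 q2]. simpl in *.
  injection x1 as x1s x1t. injection x2 as x2s x2t.
  pose proof (sin2_cos2_pow (psi s t)) as sc.
  set (S := sin (psi s t)) in *. set (C := cos (psi s t)) in *.
  (* Inserting the factor [S ^ 2 + C ^ 2 = 1] turns each inverse rotation formula into a polynomial
     identity. *)
  assert (rot : forall p q, p = (S ^ 2 + C ^ 2) * p /\ q = (S ^ 2 + C ^ 2) * q)
    by (intros; rewrite sc; lra).
  split; f_equal.
  - transitivity (C * (C * p1 + S * p2) - S * (- S * p1 + C * p2));
      [rewrite (proj1 (rot p1 p2)) at 1; ring | rewrite x1s, x2s; ring].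
  - transitivity (C * (C * q1 + S * q2) - S * (- S * q1 + C * q2));
      [rewrite (proj1 (rot q1 q2)) at 1; ring | rewrite x1t, x2t; ring].
  - transitivity (S * (C * p1 + S * p2) + C * (- S * p1 + C * p2));
      [rewrite (proj2 (rot p1 p2)) at 1; ring | rewrite x1s, x2s; ring].
  - transitivity (S * (C * q1 + S * q2) + C * (- S * q1 + C * q2));
      [rewrite (proj2 (rot q1 q2)) at 1; ring | rewrite x1t, x2t; ring].
Qed.

(** * Exterior derivatives of the rotated forms and the linear system for the derivatives of
    [psi] *)

Lemma d1_rotated_alpha1 (Q : R -> R) (psi : R -> R -> R) (s t : R) :
  ex_derive Q s -> ex_derive (fun x => psi x t) s -> ex_derive (fun y => psi s y) t ->
  d1 (fun x y => (Q x * cos (2 * psi x y), - (Q x * sin (2 * psi x y)))) s t =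
  - (Derive Q s * sin (2 * psi s t) + Q s * (2 * cos (2 * psi s t) * Ds psi s t)
     - Q s * (2 * sin (2 * psi s t) * Dt psi s t)).
Proof.
  intros dQ ds dt. unfold d1, Ds, Dt. simpl.
  erewrite (is_derive_unique (fun x => - (Q x * sin (2 * psi x t))));
    [| auto_derive; [tauto | reflexivity]].
  erewrite (is_derive_unique (fun y => Q s * cos (2 * psi s y)));
    [| auto_derive; [tauto | reflexivity]].
  change (Derive (fun x => Q x)) with (Derive Q). ring.
Qed.

(** Since [Q] depends on [s] only, [t]-derivatives fall on [psi] alone. With [Q' = Q (log Q)_s], the
    derivatives of the two rotated forms become [-Q] and [Q] times the left sides of the first
    system. *)
Lemma d1_rotated_alpha2 (Q : R -> R) (psi : R -> R -> R) (s t : R) :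
  ex_derive Q s -> ex_derive (fun x => psi x t) s -> ex_derive (fun y => psi s y) t ->
  d1 (fun x y => (Q x * sin (2 * psi x y), Q x * cos (2 * psi x y))) s t =
  Derive Q s * cos (2 * psi s t) - Q s * (2 * sin (2 * psi s t) * Ds psi s t)
  - Q s * (2 * cos (2 * psi s t) * Dt psi s t).
Proof.
  intros dQ ds dt. unfold d1, Ds, Dt. simpl.
  erewrite (is_derive_unique (fun x => Q x * cos (2 * psi x t)));
    [| auto_derive; [tauto | reflexivity]].
  erewrite (is_derive_unique (fun y => Q s * sin (2 * psi s y)));
    [| auto_derive; [tauto | reflexivity]].
  change (Derive (fun x => Q x)) with (Derive Q). ring.
Qed.

Lemma Derive_ln_comp (Q : R -> R) (s : R) :
  ex_derive Q s -> Q s > 0 -> Derive (fun x => ln (Q x)) s = Derive Q s / Q s.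
Proof.
  intros dQ Qpos. apply is_derive_unique. auto_derive; [tauto |].
  change (Derive (fun x => Q x)) with (Derive Q). field. lra.
Qed.

(** Write E1, E2 for the left sides. Then [C E1 - S E2 = 2 p] and [S E1 + C E2 = L - 2 r], a
    rotation of the equations that decouples [p = psi_s] from [r = psi_t]. *)
Lemma rotated_system_iff (S C L q p r : R) :
  S ^ 2 + C ^ 2 = 1 ->
  (S * L + 2 * C * p - 2 * S * r = 0 /\ C * L - 2 * S * p - 2 * C * r = q) <->
  (p = - (1 / 2) * q * S /\ r = 1 / 2 * L - 1 / 2 * q * C).
Proof.
  intros sc. split.
  - intros [E1 E2]. split.
    + transitivity (/ 2 * (C * (S * L + 2 * C * p - 2 * S * r)
                     - S * (C * L - 2 * S * p - 2 * C * r))).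
      * transitivity ((S ^ 2 + C ^ 2) * p); [rewrite sc; ring | field].
      * rewrite E1, E2. field.
    + transitivity (1 / 2 * L - / 2 * (S * (S * L + 2 * C * p - 2 * S * r)
                     + C * (C * L - 2 * S * p - 2 * C * r))).
      * transitivity (1 / 2 * L - (S ^ 2 + C ^ 2) * (1 / 2 * L - r));
          [rewrite sc; ring | field].
      * rewrite E1, E2. field.
  - intros [-> ->]. split; [field |].
    transitivity ((S ^ 2 + C ^ 2) * q); [field | rewrite sc; ring].
Qed.

Lemma forall_on_iff (U : R * R -> Prop) (P P' : R -> R -> Prop) :
  (forall s t, U (s, t) -> (P s t <-> P' s t)) ->
  (forall s t, U (s, t) -> P s t) <-> (forall s t, U (s, t) -> P' s t).
Proof. firstorder. Qed.

(** * From the surface data to the systems for [psi] *)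

Theorem theorem6p1 (U : R * R -> Prop) (X e1 e2 e3 : R -> R -> E3)
    (a c h k u v psi : R -> R -> R) (e A H J : R -> R) :
  let w1 := coframe X e1 in
  let w2 := coframe X e2 in
  let a1 := alpha1 w1 w2 u v in
  let a2 := alpha2 w1 w2 u v in
  let Q := fun s => Derive H s / J s in
  let logQ_s := fun s => Derive (fun x => ln (Q x)) s in
  framed_surface U X e1 e2 e3 ->
  principal_frame U X e1 e2 e3 a c ->
  connection U w1 w2 h k ->
  codazzi_functions U w1 w2 a c h k u v ->
  (forall s t, U (s, t) -> d0 (Hfun a c) s t <> (0, 0)) ->
  polar_angle U u v psi ->
  (forall s t, U (s, t) -> e s > 0) ->
  eq_on U (xi1 w1 w2 psi) (fun s _ => (e s, 0)) ->
  eq_on U (xi2 w1 w2 psi) (fun s _ => (0, e s)) ->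
  eq_on U (Afun u v) (fun s _ => A s) ->
  eq_on U (Hfun a c) (fun s _ => H s) ->
  eq_on U (Jfun a c) (fun s _ => J s) ->
  (forall s t, U (s, t) -> Q s = A s * e s /\ Q s > 0) /\
  ((eq_on U (d1 a1) (fun _ _ => 0) /\ eq_on U (d1 a2) (a1 [^] a2)) <->
   (forall s t, U (s, t) ->
      sin (2 * psi s t) * logQ_s s + 2 * cos (2 * psi s t) * Ds psi s t
        - 2 * sin (2 * psi s t) * Dt psi s t = 0 /\
      cos (2 * psi s t) * logQ_s s - 2 * sin (2 * psi s t) * Ds psi s t
        - 2 * cos (2 * psi s t) * Dt psi s t = Q s)) /\
  ((forall s t, U (s, t) ->
      sin (2 * psi s t) * logQ_s s + 2 * cos (2 * psi s t) * Ds psi s t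
        - 2 * sin (2 * psi s t) * Dt psi s t = 0 /\
      cos (2 * psi s t) * logQ_s s - 2 * sin (2 * psi s t) * Ds psi s t
        - 2 * cos (2 * psi s t) * Dt psi s t = Q s) <->
   (forall s t, U (s, t) ->
      Ds psi s t = - (1 / 2) * Q s * sin (2 * psi s t) /\
      Dt psi s t = 1 / 2 * logQ_s s - 1 / 2 * Q s * cos (2 * psi s t))).
Proof.
  intros w1 w2 a1 a2 Q logQ_s fs pf _ cz dHnz pa epos x1 x2 HA HH HJ.
  clearbody w1 w2.
  destruct fs as [oU _ _ _ _ _ _ _]. destruct pf as [sa sc _ _ ac].
  destruct pa as [spsi pu pv].
  assert (coef : forall s t, U (s, t) ->
            u s t = A s * cos (psi s t) /\ v s t = A s * sin (psi s t)).
  { intros s t Ust. rewrite <- (HA s t Ust). split; [now apply pu | now apply pv]. }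
  assert (wE : forall s t, U (s, t) ->
            w1 s t = (e s * cos (psi s t), - (e s * sin (psi s t))) /\
            w2 s t = (e s * sin (psi s t), e s * cos (psi s t))).
  { intros s t Ust. apply coframe_of_xi; [exact (x1 s t Ust) | exact (x2 s t Ust)]. }
  (* This is [dH = A J xi1] with [xi1 = e ds]. *)
  assert (dHE : eq_on U (d0 (Hfun a c)) (fun s _ => (J s * (A s * e s), 0))).
  { intros s t Ust. rewrite (d0_Hfun U w1 w2 a c h k u v sa sc ac cz s t Ust).
    unfold form_add, form_mul. simpl.
    destruct (wE s t Ust) as [-> ->]. destruct (coef s t Ust) as [-> ->].
    rewrite (HJ s t Ust). simpl. f_equal; [| ring].
    transitivity (J s * (A s * e s) * (sin (psi s t) ^ 2 + cos (psi s t) ^ 2));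
      [ring | rewrite sin2_cos2_pow; ring]. }
  assert (Jpos : forall s t, U (s, t) -> J s > 0).
  { intros s t Ust. rewrite <- (HJ s t Ust). specialize (ac s t Ust). unfold Jfun. lra. }
  assert (DH : forall s t, U (s, t) -> Derive H s = Ds (Hfun a c) s t).
  { intros s t Ust. symmetry. exact (Ds_eq_on U _ _ s t oU HH Ust). }
  assert (QE : forall s t, U (s, t) -> Q s = A s * e s).
  { intros s t Ust. unfold Q. rewrite (DH s t Ust).
    injection (dHE s t Ust) as -> _. specialize (Jpos s t Ust). field. lra. }
  assert (Qpos : forall s t, U (s, t) -> Q s > 0).
  { intros s t Ust. rewrite (QE s t Ust). apply Rmult_lt_0_compat; [| now apply (epos s t)].
    (* [A] is a square root, hence nonnegative, and [A = 0] would make [dH] vanish. *)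
    destruct (Rle_lt_or_eq_dec 0 (A s)) as [Apos | A0]; [| exact Apos |].
    - rewrite <- (HA s t Ust). apply sqrt_pos.
    - destruct (dHnz s t Ust). rewrite (dHE s t Ust), <- A0. f_equal. ring. }
  assert (dQ : forall s t, U (s, t) -> ex_derive Q s).
  { intros s t Ust.
    (* Smoothness is assumed of [a] and [c], not of [H] and [J]; so near [s], along the slice at
       height [t], [Q] is rewritten as a quotient built from [a], [c] and their [s]-derivatives. *)
    apply (ex_derive_ext_loc
             (fun x => / 2 * (Ds a x t + Ds c x t) / (/ 2 * (a x t - c x t)))).
    - apply (filter_imp (fun x => U (x, t))); [| now apply locally_slice_s].
      intros x Uxt. unfold Q.
      rewrite (DH x t Uxt), (Ds_Hfun U), <- (HJ x t Uxt) by assumption. reflexivity.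
    - pose proof (ex_derive_s U _ s t sa Ust). pose proof (ex_derive_s U _ s t sc Ust).
      pose proof (ex_derive_s U _ s t (smooth_on_Ds U a sa) Ust).
      pose proof (ex_derive_s U _ s t (smooth_on_Ds U c sc) Ust).
      specialize (ac s t Ust). auto_derive. repeat split; try assumption. lra. }
  (* One rotation by [psi] comes from [u], [v] and one from the coframe; the double-angle formulas
     combine them. *)
  assert (a1E : eq_on U a1
            (fun s t => (Q s * cos (2 * psi s t), - (Q s * sin (2 * psi s t))))).
  { intros s t Ust. unfold a1, alpha1, form_sub, form_mul.
    destruct (wE s t Ust) as [-> ->]. destruct (coef s t Ust) as [-> ->].
    rewrite (QE s t Ust), cos_2a, sin_2a. simpl. f_equal; ring. }
  assert (a2E : eq_on U a2
            (fun s t => (Q s * sin (2 * psi s t), Q s * cos (2 * psi s t)))).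
  { intros s t Ust. unfold a2, alpha2, form_add, form_mul.
    destruct (wE s t Ust) as [-> ->]. destruct (coef s t Ust) as [-> ->].
    rewrite (QE s t Ust), cos_2a, sin_2a. simpl. f_equal; ring. }
  split; [intros s t Ust; split; [now apply (QE s t) | now apply (Qpos s t)] |].
  split.
  - transitivity (forall s t, U (s, t) ->
                    d1 a1 s t = 0 /\ d1 a2 s t = (a1 [^] a2) s t);
      [split; [intros [E1 E2] s t Ust; split; [now apply E1 | now apply E2]
              | intros E; split; intros s t Ust; apply (E s t Ust)] |].
    apply forall_on_iff. intros s t Ust.
    rewrite (d1_eq_on U _ _ s t oU a1E Ust), (d1_eq_on U _ _ s t oU a2E Ust).
    pose proof (dQ s t Ust) as dQs. pose proof (Qpos s t Ust) as Qs.
    pose proof (ex_derive_s U _ s t spsi Ust). pose proof (ex_derive_t U _ s t spsi Ust).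
    rewrite d1_rotated_alpha1, d1_rotated_alpha2 by assumption.
    unfold wedge, logQ_s. rewrite (a1E s t Ust), (a2E s t Ust), Derive_ln_comp by assumption.
    simpl. pose proof (sin2_cos2_pow (2 * psi s t)) as sc2.
    set (S := sin (2 * psi s t)) in *. set (C := cos (2 * psi s t)) in *.
    (* The wedge product of the two forms has coefficient [Q ^ 2]. *)
    replace (Q s * C * (Q s * C) - - (Q s * S) * (Q s * S)) with (Q s * Q s)
      by (transitivity (Q s * Q s * (S ^ 2 + C ^ 2)); [rewrite sc2; ring | ring]).
    (* Only the occurrences coming from [d1 a1] and [d1 a2] are rewritten, so that [Q] factors out
       of both equations and can be cancelled; the others already sit inside [(log Q)_s]. *)
    replace (Derive Q s) with (Q s * (Derive Q s / Q s)) at 1 2 by (field; lra).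
    set (L := Derive Q s / Q s). set (p := Ds psi s t). set (r := Dt psi s t).
    split; intros [E1 E2]; split.
    + apply (Rmult_eq_reg_l (Q s)); lra.
    + apply (Rmult_eq_reg_l (Q s)); lra.
    + transitivity (- (Q s * (S * L + 2 * C * p - 2 * S * r))); [ring | rewrite E1; ring].
    + transitivity (Q s * (C * L - 2 * S * p - 2 * C * r)); [ring | now rewrite E2].
  - apply forall_on_iff. intros s t _. apply rotated_system_iff, sin2_cos2_pow.
Qed.
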